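(* Let $\mathcal{A}$ be a countable dimensional locally matrix algebra (over $\mathbb{C}$) having a non-trivial idempotent $e$. Then $\mathcal{A}$ is a zero Lie product determined algebra.
   Context: An associative complex algebra $\mathcal{A}$ is a locally matrix algebra if for each finite subset of $\mathcal{A}$ there is a subalgebra $\mathcal{B}\subset\mathcal{A}$ containing this subset such that $\mathcal{B}\cong M_n(\mathbb{C})$ for some $n$. The algebra $\mathcal{A}$ need not be unital. An algebra $\mathcal{A}$ is zero Lie product determined if for every bilinear functional $\phi$ on $\mathcal{A}\times\mathcal{A}$ satisfying $\phi(x,y)=0$ whenever $x$ and $y$ commute, there is a linear functional $\tau$ on $[\mathcal{A},\mathcal{A}]$ with $\phi(x,y)=\tau([x,y])$ for all $x,y\in\mathcal{A}$; here $[x,y]=xy-yx$ and $[\mathcal{A},\mathcal{A}]$ is the linear span of all commutators of $\mathcal{A}$. *)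

(* Defs.v *)
From HB Require Import structures.
From mathcomp Require Import all_boot all_order all_algebra.
From mathcomp Require Import boolp classical_sets functions cardinality reals.
From mathcomp Require Export complex.

Set Implicit Arguments.
Unset Strict Implicit.
Unset Printing Implicit Defensive.

Import GRing.Theory.
Local Open Scope classical_set_scope.
Local Open Scope ring_scope.

(* MathComp's algType is unital, so associative algebras without the
   assumption of a unit get their own structure. *)
HB.mixin Record Lmodule_isNonUnitalAlgebra (K : fieldType) A
    of GRing.Lmodule K A := {
  amul : A -> A -> A;
  amulA : associative amul;
  amulDl : left_distributive amul +%R;
  amulDr : right_distributive amul +%R;
  amulZl : forall (a : K) x y, amul (a *: x) y = a *: amul x y;
  amulZr : forall (a : K) x y, amul x (a *: y) = a *: amul x y
}.

#[short(type="nonUnitalAlgType")]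
HB.structure Definition NonUnitalAlgebra (K : fieldType) :=
  {A of Lmodule_isNonUnitalAlgebra K A & GRing.Lmodule K A}.

Declare Scope nualg_scope.
Delimit Scope nualg_scope with nualg.
Local Open Scope nualg_scope.

Notation "x ** y" := (amul x y)
  (at level 40, left associativity) : nualg_scope.

Section LinearSpan.
Variables (K : fieldType) (V : lmodType K).

Definition lin_span (S : set V) : set V :=
  [set z | exists n (c : 'I_n -> K) (v : 'I_n -> V),
     (forall i, S (v i)) /\ z = \sum_(i < n) c i *: v i].

Lemma lin_span_submod_closed (S : set V) :
  submod_closed [pred x | x \in lin_span S].
Proof.
split=> [|a x y]; rewrite !inE.
  exists 0%N, (fun=> 0), (fun=> 0); split; first by case.
  by rewrite big_ord0.
move=> [m [c [v [Sv ->]]]] [n [d [w [Sw ->]]]].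
exists (m + n)%N,
  (fun i => match fintype.split i with inl j => a * c j | inr k => d k end),
  (fun i => match fintype.split i with inl j => v j | inr k => w k end).
split; first by move=> i; case: (fintype.split i).
rewrite big_split_ord /= scaler_sumr; congr (_ + _); apply: eq_bigr => i _.
  by rewrite (unsplitK (inl _ i)) scalerA.
by rewrite (unsplitK (inr _ i)).
Qed.

Record span_of (S : set V) := SpanOf {
  span_val : V;
  span_valP : span_val \in [pred x | x \in lin_span S] }.

HB.instance Definition _ (S : set V) := [isSub for @span_val S].
HB.instance Definition _ (S : set V) := [Choice of span_of S by <:].
HB.instance Definition _ (S : set V) :=
  GRing.SubChoice_isSubLmodule.Build K V _ (span_of S)
    (lin_span_submod_closed S).

Definition lin_indep (S : set V) : Prop :=
  forall n (v : 'I_n -> V) (c : 'I_n -> K),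
    injective v -> (forall i, S (v i)) ->
    \sum_(i < n) c i *: v i = 0 -> forall i, c i = 0.

Definition is_basis (S : set V) : Prop :=
  lin_indep S /\ lin_span S = setT.

(* Finite dimensional spaces are included. *)
Definition countable_dim : Prop :=
  exists S : set V, countable S /\ is_basis S.

End LinearSpan.

Section NonUnitalAlgebras.
Variables (K : fieldType) (A : nonUnitalAlgType K).

Definition commutator (x y : A) : A := x ** y - y ** x.

Definition commutators : set A :=
  [set z | exists x y, z = commutator x y].

Notation commutator_space := (span_of commutators).

Lemma commutator_in_span (x y : A) :
  commutator x y \in [pred z | z \in lin_span commutators].
Proof.
rewrite !inE; exists 1%N, (fun=> 1), (fun=> commutator x y); split.
  by move=> _; exists x, y.
by rewrite big_ord1 scale1r.
Qed.

Definition lie_bracket (x y : A) : commutator_space :=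
  SpanOf (commutator_in_span x y).

Definition zero_Lie_product_determined : Prop :=
  forall phi : {biscalar A},
    (forall x y : A, x ** y = y ** x -> phi x y = 0) ->
    exists tau : {scalar commutator_space},
      forall x y : A, phi x y = tau (lie_bracket x y).

Definition subalgebra (B : set A) : Prop :=
  [/\ B 0,
      forall (a : K) x y, B x -> B y -> B (a *: x + y)
    & forall x y, B x -> B y -> B (x ** y)].

(* The unit of B need not be a unit of A. *)
Definition isomorphic_to_matrices (B : set A) (n : nat) : Prop :=
  exists f : {linear 'M[K]_n -> A},
    set_bij setT B f /\ forall M N : 'M[K]_n, f (M *m N) = f M ** f N.

Definition locally_matrix : Prop :=
  forall F : set A, finite_set F ->
    exists B : set A, [/\ subalgebra B, F `<=` B
      & exists n : nat, (0 < n)%N /\ isomorphic_to_matrices B n].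

Definition is_unity (u : A) : Prop := forall x : A, u ** x = x /\ x ** u = x.

(* If A has no unit, every nonzero idempotent is non-trivial. *)
Definition nontrivial_idempotent (e : A) : Prop :=
  [/\ e ** e = e, e <> 0 & ~ is_unity e].

End NonUnitalAlgebras.

(* Main.v *)
Require Import Defs.
From HB Require Import structures.
From mathcomp Require Import all_boot all_order all_algebra.
From mathcomp Require Import boolp classical_sets functions cardinality.
From mathcomp Require Import reals complex.

Set Implicit Arguments.
Unset Strict Implicit.
Unset Printing Implicit Defensive.

Import GRing.Theory.
Local Open Scope ring_scope.
Local Open Scope nualg_scope.

(** Whether some functional tau satisfies phi(x,y) = tau([x,y]) is a matter of
    finite sums: writing an element of [A,A] as a sum of commutators
    [x_p,y_p], the only candidate value of tau is the sum of the phi(x_p,y_p),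
    and this is well defined exactly when a vanishing sum of commutators forces
    the corresponding sum of values of phi to vanish
    ([zero_Lie_product_determined_sum]). A relation of this kind involves
    finitely many elements, so in a locally matrix algebra it takes place
    inside a copy of M_n, to which phi restricts ([sum_vanishing_eq0]).

    It remains to treat a form phi on M_n(K) that vanishes on commuting pairs,
    over any field K. Such a phi is antisymmetric and is determined by its
    values on pairs of matrix units. Testing it on well chosen commuting pairs
    gives three facts: phi(E_ij,E_kl) = 0 when both products of the two units
    are zero; phi(E_ij,E_jl) does not depend on j when i <> l
    ([vanishing_delta_offdiag]); and c(i,j) = phi(E_ij,E_ji) is additive,
    c(i,j) + c(j,k) + c(k,i) = 0 ([vanishing_delta_cocycle]). Hence the
    functional with tau(E_il) = phi(E_i0,E_0l), the diagonal case i = l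
    included, satisfies phi(M,N) = tau(MN - NM). Like every functional on M_n
    it has the form M |-> tr(WM) ([vanishing_trace_form]). *)

(** * Bilinear forms on matrices *)

Definition pullback (K : fieldType) (U V : lmodType K) (phi : {biscalar V})
  (f : {linear U -> V}) (x y : U) : K := phi (f x) (f y).

Lemma pullback_is_bilinear (K : fieldType) (U V : lmodType K)
    (phi : {biscalar V}) (f : {linear U -> V}) :
  bilinear_for *%R *%R (pullback phi f).
Proof.
by split=> [y a x x'|x a y y']; rewrite /pullback linearP ?linearPl ?linearPr.
Qed.

HB.instance Definition _ (K : fieldType) (U V : lmodType K)
    (phi : {biscalar V}) (f : {linear U -> V}) :=
  bilinear_isBilinear.Build K U U K *%R *%R (pullback phi f)
    (pullback_is_bilinear phi f).

Definition trace_form (K : fieldType) n (W M N : 'M[K]_n) : K :=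
  \tr (W *m (M *m N - N *m M)).

Lemma trace_form_is_bilinear (K : fieldType) n (W : 'M[K]_n) :
  bilinear_for *%R *%R (trace_form W).
Proof.
split=> [N a M M'|M a N N'] /=; rewrite /trace_form -mxtraceZ -raddfD /=;
  rewrite scalemxAr -mulmxDr; congr (\tr (W *m _));
  rewrite !(mulmxDl, mulmxDr) -!(scalemxAl, scalemxAr) scalerBr;
  by rewrite opprD addrACA.
Qed.

HB.instance Definition _ (K : fieldType) n (W : 'M[K]_n) :=
  bilinear_isBilinear.Build K _ _ K *%R *%R (trace_form W)
    (trace_form_is_bilinear W).

Lemma mxtrace_mul_delta (K : fieldType) n (W : 'M[K]_n) (i j : 'I_n) :
  \tr (W *m delta_mx i j) = W j i.
Proof.
rewrite /mxtrace (bigD1 j) //= big1 ?addr0 => [|k kj].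
  rewrite mxE (bigD1 i) //= big1 ?addr0 => [|k ki]; rewrite mxE ?eqxx ?mulr1 //.
  by rewrite (negPf ki) mulr0.
by rewrite mxE big1 // => l _; rewrite mxE (negPf kj) andbF mulr0.
Qed.

Lemma eq_biscalar_delta (K : fieldType) n (phi psi : {biscalar 'M[K]_n}) :
  (forall i j k l : 'I_n, phi (delta_mx i j) (delta_mx k l) =
                          psi (delta_mx i j) (delta_mx k l)) ->
  forall M N, phi M N = psi M N.
Proof.
move=> eq_delta M N; rewrite (matrix_sum_delta M) !linear_sumlz.
apply: eq_bigr => i _; rewrite !linear_sumlz; apply: eq_bigr => j _.
rewrite !linearZl_LR /=; congr (_ * _).
rewrite (matrix_sum_delta N) !linear_sumr.
apply: eq_bigr => k _; rewrite !linear_sumr; apply: eq_bigr => l _.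
by rewrite !linearZr_LR /= eq_delta.
Qed.

(** * Forms on matrices vanishing on commuting pairs *)

Definition vanishes_on_commuting (K : fieldType) n
    (phi : {biscalar 'M[K]_n}) : Prop :=
  forall M N : 'M[K]_n, M *m N = N *m M -> phi M N = 0.

(** Polarization of phi(M + N, M + N) = 0. *)
Lemma vanishing_antisym (K : fieldType) n (phi : {biscalar 'M[K]_n}) :
  vanishes_on_commuting phi -> forall M N, phi M N = - phi N M.
Proof.
move=> phi0 M N; apply/eqP; rewrite -addr_eq0; apply/eqP.
have := phi0 (M + N) (M + N) erefl.
by rewrite linearDl /= !linearDr /= (phi0 M M) // (phi0 N N) // add0r addr0.
Qed.

Lemma vanishing_delta_eq0 (K : fieldType) n (phi : {biscalar 'M[K]_n})
    (i j k l : 'I_n) :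
  vanishes_on_commuting phi -> j != k -> l != i ->
  phi (delta_mx i j) (delta_mx k l) = 0.
Proof. by move=> phi0 jk li; apply: phi0; rewrite !mul_delta_mx_0. Qed.

(** For j <> k, the matrices E_ij + E_ik and E_jl - E_kl have product
    E_il - E_il = 0, and product 0 in the other order because l <> i. Expanding
    phi on this commuting pair, the two cross terms vanish. *)
Lemma vanishing_delta_offdiag (K : fieldType) n (phi : {biscalar 'M[K]_n})
    (i l j k : 'I_n) :
  vanishes_on_commuting phi -> i != l ->
  phi (delta_mx i j) (delta_mx j l) = phi (delta_mx i k) (delta_mx k l).
Proof.
move=> phi0 il; have [<-//|jk] := eqVneq j k.
have li : l != i by rewrite eq_sym.
have kj : k != j by rewrite eq_sym.
pose M : 'M[K]_n := delta_mx i j + delta_mx i k.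
pose N : 'M[K]_n := delta_mx j l - delta_mx k l.
have comm : M *m N = N *m M.
  rewrite !(mulmxDl, mulmxDr, mulmxN, mulNmx) !mul_delta_mx_cond !eqxx.
  rewrite (negPf jk) (negPf kj) (negPf li) !mulr0n !mulr1n !oppr0 addr0 !add0r.
  by rewrite subrr.
have := phi0 _ _ comm; rewrite linearDl /= !linearBr /=.
rewrite (vanishing_delta_eq0 phi0 jk li) (vanishing_delta_eq0 phi0 kj li).
by rewrite subr0 sub0r => /eqP; rewrite subr_eq0 => /eqP.
Qed.

(** When i, j, k are distinct, M = E_ij + E_jk + E_ki and N = E_ji + E_kj + E_ik
    are the permutation matrices of a 3-cycle and of its inverse, extended by
    zero, so that MN = NM = E_ii + E_jj + E_kk. In the expansion of
    phi(M,N) = 0 the terms other than these three are zero. When two indices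
    agree the relation reduces to antisymmetry. *)
Lemma vanishing_delta_cocycle (K : fieldType) n (phi : {biscalar 'M[K]_n})
    (i j k : 'I_n) :
  vanishes_on_commuting phi ->
  phi (delta_mx i j) (delta_mx j i) + phi (delta_mx j k) (delta_mx k j)
    + phi (delta_mx k i) (delta_mx i k) = 0.
Proof.
move=> phi0; have asym := vanishing_antisym phi0.
have [<-|ij] := eqVneq i j.
  by rewrite (phi0 (delta_mx i i)) // add0r asym addNr.
have [<-|jk] := eqVneq j k.
  by rewrite (phi0 (delta_mx j j)) // addr0 asym addNr.
have [<-|ki] := eqVneq k i.
  by rewrite (phi0 (delta_mx k k)) // addr0 asym addNr.
have [ji kj ik] : [/\ j != i, k != j & i != k] by split; rewrite eq_sym.
have d0 := vanishing_delta_eq0 phi0.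
pose M : 'M[K]_n := delta_mx i j + delta_mx j k + delta_mx k i.
pose N : 'M[K]_n := delta_mx j i + delta_mx k j + delta_mx i k.
have comm : M *m N = N *m M.
  rewrite !(mulmxDl, mulmxDr) !mul_delta_mx_cond !eqxx.
  rewrite !(negPf ij, negPf jk, negPf ki, negPf ji, negPf kj, negPf ik).
  rewrite !mulr0n !mulr1n !(addr0, add0r).
  by rewrite -addrA addrC.
have := phi0 _ _ comm.
rewrite !linearDl /= !linearDr /=.
rewrite (d0 i j k j) ?(d0 i j i k) ?(d0 j k j i) ?(d0 j k i k) //.
by rewrite (d0 k i j i) ?(d0 k i k j) // !(addr0, add0r).
Qed.

(** Both sides are bilinear, so it is enough to compare them on a pair of matrix
    units E_ij, E_kl. According to whether j = k and whether l = i, the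
    comparison is additivity on the diagonal, independence of the middle index
    (for either order of the pair), or 0 = 0. *)
Lemma vanishing_trace_form (K : fieldType) n (phi : {biscalar 'M[K]_n.+1}) :
  vanishes_on_commuting phi ->
  exists W : 'M[K]_n.+1, forall M N, phi M N = \tr (W *m (M *m N - N *m M)).
Proof.
move=> phi0; have asym := vanishing_antisym phi0.
(* The entry W l i is the value of M |-> tr(WM) at E_il. Any other
   middle index would do in place of 0. *)
exists (\matrix_(l, i) phi (delta_mx i ord0) (delta_mx ord0 l)).
move=> M N; set W := (X in X *m _); rewrite -/(trace_form W M N).
apply: eq_biscalar_delta => {M N} i j k l.
rewrite /= /trace_form mulmxBr raddfB /= !mul_delta_mx_cond.
have [<-|jk] := eqVneq j k; have [->|li] := eqVneq l i;
  rewrite ?mulr0n ?mulr1n ?mulmx0 ?mxtrace0 ?sub0r ?subr0 ?mxtrace_mul_delta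
    ?mxE.
- apply/eqP; rewrite -subr_eq0 opprB (asym (delta_mx i ord0)) opprK addrA.
  by rewrite vanishing_delta_cocycle.
- by apply: vanishing_delta_offdiag; rewrite // eq_sym.
- by rewrite asym; congr (- _); apply: vanishing_delta_offdiag; rewrite // eq_sym.
- by rewrite oppr0; apply: vanishing_delta_eq0.
Qed.

(** * From matrices to locally matrix algebras *)

(** All the entries of s lie in a single copy of M_n. There phi factors through
    the trace form of some W, so the sum of its values on s is the functional
    M |-> tr(WM) applied to a sum of commutators, which vanishes because M_n
    embeds in A. *)
Lemma sum_vanishing_eq0 (K : fieldType) (A : nonUnitalAlgType K)
    (phi : {biscalar A}) (s : seq (A * A)) :
  locally_matrix A -> (forall x y : A, x ** y = y ** x -> phi x y = 0) ->
  \sum_(p <- s) commutator p.1 p.2 = 0 -> \sum_(p <- s) phi p.1 p.2 = 0.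
Proof.
move=> hloc phi0 sum0.
have fin : finite_set [set` unzip1 s ++ unzip2 s] by exact: finite_seq.
have [B [_ sB [[|n] [n_gt0 [f [[_ f_inj f_surj] fM]]]]]] := hloc _ fin.
  by [].
have /choice[g gK] : forall x, exists M, x \in unzip1 s ++ unzip2 s -> f M = x.
  move=> x; have [xs|] := boolP (x \in _); last by exists 0.
  by have [M _ <-] := f_surj _ (sB _ xs); exists M.
have g1K p : p \in s -> f (g p.1) = p.1.
  by move=> ps; rewrite gK // mem_cat map_f.
have g2K p : p \in s -> f (g p.2) = p.2.
  by move=> ps; rewrite gK // mem_cat map_f ?orbT.
have [M N MN|W phiE] := @vanishing_trace_form K _ (pullback phi f).
  by apply: phi0; rewrite -!fM MN.
transitivity (\sum_(p <- s) pullback phi f (g p.1) (g p.2)).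
  by apply: eq_big_seq => p ps; rewrite /pullback g1K ?g2K.
under eq_bigr do rewrite phiE.
rewrite -raddf_sum -mulmx_sumr /=.
suff -> : \sum_(p <- s) (g p.1 *m g p.2 - g p.2 *m g p.1) = 0.
  by rewrite mulmx0 mxtrace0.
apply: f_inj; rewrite ?inE // raddf0 raddf_sum -[RHS]sum0.
by apply: eq_big_seq => p ps; rewrite raddfB /= !fM g1K ?g2K.
Qed.

Lemma commutatorZl (K : fieldType) (A : nonUnitalAlgType K) (a : K) (x y : A) :
  commutator (a *: x) y = a *: commutator x y.
Proof. by rewrite /commutator amulZl amulZr scalerBr. Qed.

(** Coefficients are absorbed into the first entry of each commutator, since
    multiples of commutators are commutators. *)
Lemma span_commutatorsP (K : fieldType) (A : nonUnitalAlgType K)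
    (z : span_of (@commutators K A)) :
  exists s : seq (A * A), val z = \sum_(p <- s) commutator p.1 p.2.
Proof.
case: z => z /=; rewrite !inE => -[n [c [v [/choice[x /choice[y vE]] ->]]]].
exists [seq (c i *: x i, y i) | i <- enum 'I_n].
by rewrite big_map big_enum; apply: eq_bigr => i _; rewrite vE commutatorZl.
Qed.

(** The hypothesis says that two ways of writing an element of [A,A] as a sum of
    commutators assign it the same value, so tau can be computed from any chosen
    representation. *)
Lemma zero_Lie_product_determined_sum (K : fieldType) (A : nonUnitalAlgType K) :
  (forall (phi : {biscalar A}) (s : seq (A * A)),
     (forall x y : A, x ** y = y ** x -> phi x y = 0) ->
     \sum_(p <- s) commutator p.1 p.2 = 0 -> \sum_(p <- s) phi p.1 p.2 = 0) ->
  zero_Lie_product_determined A.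
Proof.
move=> sum0 phi phi0; have [r rE] := choice (@span_commutatorsP K A).
pose scale a (s : seq (A * A)) := [seq (a *: p.1, p.2) | p <- s].
have sum_comm a s t : \sum_(p <- scale a s ++ t) commutator p.1 p.2 =
    a *: (\sum_(p <- s) commutator p.1 p.2) + \sum_(p <- t) commutator p.1 p.2.
  rewrite big_cat big_map scaler_sumr; congr (_ + _).
  by apply: eq_bigr => p _; rewrite commutatorZl.
have sum_phi a s t : \sum_(p <- scale a s ++ t) phi p.1 p.2 =
    a * (\sum_(p <- s) phi p.1 p.2) + \sum_(p <- t) phi p.1 p.2.
  rewrite big_cat big_map mulr_sumr; congr (_ + _).
  by apply: eq_bigr => p _; rewrite linearZl_LR.
pose tau z := \sum_(p <- r z) phi p.1 p.2.
have tauE z s : val z = \sum_(p <- s) commutator p.1 p.2 ->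
    tau z = \sum_(p <- s) phi p.1 p.2.
  (* The representation s minus the chosen one represents 0. *)
  move=> zE; apply/esym/eqP; rewrite -subr_eq0 addrC -mulN1r -sum_phi.
  by apply/eqP/sum0; rewrite // sum_comm -rE -zE scaleN1r addNr.
have tau_lin : scalar tau.
  move=> a u v; rewrite (tauE _ (scale a (r u) ++ r v)) ?sum_phi //.
  by rewrite sum_comm -!rE.
pose tauL : {scalar span_of (@commutators K A)} :=
  HB.pack tau (GRing.isLinear.Build _ _ _ _ tau tau_lin).
exists tauL => x y.
by rewrite /= (tauE _ [:: (x, y)]) ?big_seq1.
Qed.

Theorem theorem6 (R : realType) (A : nonUnitalAlgType R[i])
    (hdim : countable_dim A) (hloc : locally_matrix A)
    (e : A) (he : nontrivial_idempotent e) :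
  zero_Lie_product_determined A.
Proof.
apply: zero_Lie_product_determined_sum => phi s.
exact: sum_vanishing_eq0.
Qed.
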